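(* Let $I=(i_1,\dots,i_k)$ and $J=(j_1,\dots,j_l)$ be compositions of $n$. Then the coefficient $C_I^J(q)$ of $\Psi_I$ in $S^J(q)$ is given by the following rule: (i) if $i_1<j_1$, then $C_I^J(q)=C_{(i_1+i_2,i_3,\dots,i_k)}^J(q)$; (ii) otherwise, \[ C_I^J(q) = \left[\begin{matrix} k+j_1-1\\ j_1\end{matrix}\right]_q C_{I'}^{(j_2,\dots,j_l)}(q), \] where the (ribbon) diagram of $I'$ is obtained by removing the first $j_1$ cells of the diagram of $I$.
   Context: $\mathbf{Sym}$ is the algebra of noncommutative symmetric functions, with complete functions $S_n$ and Tevlin's noncommutative monomial basis $\Psi_I$. $\mathbf{WQSym}$ has basis $\mathbf{M}_u$ indexed by packed words $u$. For a packed word $u$, a special inversion is a pair $i<j$ with $u_i>u_j$ such that $u_j$ is the rightmost occurrence of its letter in $u$; $\mathrm{sinv}(u)$ is their number. The $q$-product $\star_q$ on $\mathbf{WQSym}$ is defined by requiring that the elements $\mathbf{M}'_u=q^{\mathrm{sinv}(u)}\mathbf{M}_u$ multiply (under $\star_q$) exactly as the $\mathbf{M}_u$ multiply under the usual product. The W-composition $\mathrm{WC}(u)$ of a packed word $u$ is the composition whose descent set is the set of positions of the last occurrences of each letter in $u$; the map $\zeta:\mathbf{M}_u\mapsto\Psi_{\mathrm{WC}(u)}$ is an algebra morphism from $\mathbf{WQSym}$ onto $\mathbf{Sym}$. Let $\alpha(S_n)=\sum_u \mathbf{M}_u$ over nondecreasing packed words $u$ of length $n$. For a composition $J=(j_1,\dots,j_r)$,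 $S^J(q)=\zeta(\alpha(S_{j_1})\star_q\cdots\star_q\alpha(S_{j_r}))$, and $C_I^J(q)$ denotes the coefficient of $\Psi_I$ in $S^J(q)$. $\left[\begin{matrix} a\\ b\end{matrix}\right]_q$ denotes the Gaussian $q$-binomial coefficient. *)

(* Defs.v *)
From HB Require Import structures.
From mathcomp Require Import all_boot all_order all_algebra.
Set Implicit Arguments. Unset Strict Implicit. Unset Printing Implicit Defensive.
Import GRing.Theory.

Definition packed (u : seq nat) : bool :=
  (0 \notin u) && all (fun i => i \in u) (iota 1 (foldr maxn 0 u)).

Fixpoint words (n m : nat) : seq (seq nat) :=
  if n is n'.+1 then [seq a :: w | a <- iota 1 m, w <- words n' m] else [:: [::]].

Definition packed_words (n : nat) : seq (seq nat) := [seq u <- words n n | packed u].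

Definition pack (w : seq nat) : seq nat :=
  [seq (index x (sort leq (undup w))).+1 | x <- w].

Definition last_occ (u : seq nat) (j : nat) : bool := nth 0 u j \notin drop j.+1 u.

Definition sinv (u : seq nat) : nat :=
  \sum_(0 <= j < size u) \sum_(0 <= i < j) ((nth 0 u j < nth 0 u i) && last_occ u j).

(* W-composition: positions (1-based) p_1 < ... < p_m of last occurrences
   (p_m = size u), WC u = (p_1, p_2 - p_1, ..., p_m - p_(m-1)). *)
Definition last_positions (u : seq nat) : seq nat :=
  [seq j.+1 | j <- iota 0 (size u) & last_occ u j].
Definition WC (u : seq nat) : seq nat := pairmap (fun a b => b - a) 0 (last_positions u).

Definition is_comp (n : nat) (I : seq nat) : bool :=
  (sumn I == n) && all (fun i => 0 < i) I.

Local Open Scope ring_scope.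

Definition Rq := {fraction {poly int}}.
Definition qq : Rq := @FracField.tofrac {poly int} 'X.

Definition qint (m : nat) : Rq := \sum_(i < m) qq ^+ i.
Definition qfact (m : nat) : Rq := \prod_(1 <= i < m.+1) qint i.
Definition qbinom (a b : nat) : Rq :=
  if (b <= a)%N then qfact a / (qfact b * qfact (a - b)) else 0.

(* ---------- WQSym over Q(q), as formal finite sums of M_u ---------- *)
Definition WQSym := seq (seq nat * Rq).

Definition coefM (x : WQSym) (u : seq nat) : Rq := \sum_(t <- x | t.1 == u) t.2.

(* usual product M_u M_v = sum of M_w, w packed of length |u|+|v| with
   pack(w_1..w_|u|) = u and pack(rest) = v *)
Definition prodM (u v : seq nat) : seq (seq nat) :=
  [seq w <- packed_words (size u + size v) |
     (pack (take (size u) w) == u) && (pack (drop (size u) w) == v)].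

(* q-product on the M basis, determined by M'_u *_q M'_v = sum_w M'_w
   where M'_u = q^sinv(u) M_u, i.e.
   M_u *_q M_v = q^(-sinv u - sinv v) sum_w q^(sinv w) M_w *)
Definition starq_basis (u v : seq nat) : WQSym :=
  [seq (w, qq ^+ sinv w / (qq ^+ sinv u * qq ^+ sinv v)) | w <- prodM u v].

Definition starq (x y : WQSym) : WQSym :=
  flatten [seq [seq (w.1, s.2 * t.2 * w.2) | w <- starq_basis s.1 t.1] | s <- x, t <- y].

Definition oneW : WQSym := [:: ([::], 1)].

Definition alphaS (n : nat) : WQSym :=
  [seq (u, 1) | u <- packed_words n & sorted leq u].

Definition prodJ (J : seq nat) : WQSym := foldr (fun j acc => starq (alphaS j) acc) oneW J.

(* ---------- Sym, as formal finite sums of Psi_I ---------- *)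
Definition Sym := seq (seq nat * Rq).
Definition coefPsi (f : Sym) (I : seq nat) : Rq := \sum_(t <- f | t.1 == I) t.2.

Definition zeta (x : WQSym) : Sym := [seq (WC t.1, t.2) | t <- x].

Definition SJ (J : seq nat) : Sym := zeta (prodJ J).

Definition CIJ (I J : seq nat) : Rq := coefPsi (SJ J) I.

(* ribbon diagram of I with its first j cells (in reading order) removed *)
Fixpoint remove_cells (j : nat) (I : seq nat) : seq nat :=
  if j is 0 then I else
  match I with
  | [::] => [::]
  | i :: I' => if (j < i)%N then (i - j)%N :: I' else remove_cells (j - i) I'
  end.

(* Main.v *)
(* Record a packed word w by the positions of its last occurrences together with
   its code c, where c_i is the number of distinct letters to the right of
   position i that are smaller than w_i.  Then sinv w is the sum of the c_i, each
   c_i ranges freely over [0, k_i) with k_i the number of last occurrences at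
   positions >= i, and w_i <= w_(i+1) iff c_i <= c_(i+1).  Expanding S^J(q) thus
   gives a sum over codes that are nondecreasing on the blocks of J; since k is
   nonincreasing, only the bound at the end of a block matters, and each block of
   length j contributes the factor qbinom (K + j - 1) j with K the value of k at
   its last position.  Both rules are read off this product formula. *)

Require Import Defs.
From HB Require Import structures.
From mathcomp Require Import all_boot all_order all_algebra.
From mathcomp Require Import zify ring.
Import GRing.Theory.
Local Open Scope ring_scope.

(** * Flags of last occurrences, codes, and their encodings *)

Fixpoint last_flags (w : seq nat) : seq bool :=
  if w is a :: v then (a \notin v) :: last_flags v else [::].

Fixpoint code (w : seq nat) : seq nat :=
  if w is a :: v then count (fun x => (x < a)%N) (undup v) :: code v else [::].

Fixpoint blocks_sorted (J w : seq nat) : bool :=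
  if J is j :: J' then sorted leq (take j w) && blocks_sorted J' (drop j w)
  else true.

(* The front letter is new when b holds, and v is then shifted to make room for it. *)
Definition insert_letter (b : bool) (c : nat) (v : seq nat) : seq nat :=
  c.+1 :: (if b then [seq bump c.+1 x | x <- v] else v).

(** A new front letter has one more possible value than there are distinct letters behind it, a
    repeated one exactly as many; [count id bs] covers both cases. *)
Fixpoint flagged_words (bs : seq bool) : seq (seq nat) :=
  if bs is b :: bs' then
    [seq insert_letter b c v
       | c <- iota 0 (count id bs), v <- flagged_words bs']
  else [:: [::]].

Fixpoint codes (bs : seq bool) : seq (seq nat) :=
  if bs is b :: bs' then
    [seq c :: cs | c <- iota 0 (count id bs), cs <- codes bs']
  else [:: [::]].

(** A part 0 would be encoded like a part 1, so decoding assumes positive parts. *)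
Fixpoint comp_flags (I : seq nat) : seq bool :=
  if I is i :: I' then nseq i.-1 false ++ true :: comp_flags I' else [::].

(* acc counts the cells of the current part that have already been read. *)
Fixpoint flags_comp (acc : nat) (bs : seq bool) : seq nat :=
  if bs is b :: bs' then
    if b then acc.+1 :: flags_comp 0 bs' else flags_comp acc.+1 bs'
  else [::].

(** * W-compositions as flag sequences *)

Lemma size_last_flags w : size (last_flags w) = size w.
Proof. by elim: w => //= a v ->. Qed.

Lemma nth_last_flags w j : (j < size w)%N -> nth false (last_flags w) j = last_occ w j.
Proof.
elim: w j => [|a v IH] [|j] //= lt_j; first by rewrite /last_occ /= drop0.
exact: IH.
Qed.

Lemma last_last_flags w : last true (last_flags w).
Proof. by elim: w => //= a [|b v] //= IH. Qed.

Lemma size_undup_flags w : size (undup w) = count id (last_flags w).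
Proof. by elim: w => //= a v IH; case: (a \in v); rewrite //= IH. Qed.

Lemma last_flags_map (f : nat -> nat) w :
  injective f -> last_flags (map f w) = last_flags w.
Proof. by move=> finj; elim: w => //= a v ->; rewrite mem_map. Qed.

Lemma WC_flags w : WC w = flags_comp 0 (last_flags w).
Proof.
(* Here [p] is the last position recorded and [s] the number of letters read, so [s - p] is the
   accumulator. *)
have gen bs p s : (p <= s)%N ->
    pairmap (fun a b => b - a)%N p
      [seq j.+1 | j <- iota s (size bs) & nth false bs (j - s)]
      = flags_comp (s - p) bs.
  elim: bs p s => [|b bs IH] p s le_ps //=.
  rewrite subnn /=.
  have -> : [seq j <- iota s.+1 (size bs) | nth false (b :: bs) (j - s)]
          = [seq j <- iota s.+1 (size bs) | nth false bs (j - s.+1)].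
    apply: eq_in_filter => j; rewrite mem_iota => /andP[lt_sj _].
    by rewrite -(subnSK lt_sj).
  case: b => /=; first by rewrite IH // subnn subSn.
  by rewrite IH ?subSn // ltnW.
rewrite /WC /last_positions -[RHS](gen _ 0%N 0%N) // size_last_flags.
congr (pairmap _ _ (map _ _)); apply: eq_in_filter => j; rewrite mem_iota subn0.
by move=> /andP[_ lt_j]; rewrite nth_last_flags.
Qed.

Lemma comp_flagsK I : all (fun i => 0 < i)%N I -> flags_comp 0 (comp_flags I) = I.
Proof.
have gen m acc bs : flags_comp acc (nseq m false ++ true :: bs)
                    = (acc + m).+1 :: flags_comp 0 bs.
  by elim: m acc => [|m IH] acc /=; rewrite ?addn0 // IH addSnnS.
by elim: I => //= i I IH /andP[i_gt0 /IH E]; rewrite gen E add0n prednK.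
Qed.

Lemma flags_compK bs : last true bs -> comp_flags (flags_comp 0 bs) = bs.
Proof.
(* Without flags left no cell may be pending; otherwise the last flag must close the final part. *)
have gen acc : last (acc == 0%N) bs ->
    comp_flags (flags_comp acc bs) = nseq acc false ++ bs.
  elim: bs acc => [|b bs IH] acc /=; first by move/eqP->.
  case: b => /= lastb; first by rewrite IH.
  by rewrite IH //=; elim: (acc) => //= m ->.
by move=> /(gen 0%N).
Qed.

Lemma WC_eq w I : all (fun i => 0 < i)%N I ->
  (WC w == I) = (last_flags w == comp_flags I).
Proof.
move=> I_gt0; rewrite WC_flags; apply/eqP/eqP => [<-|->].
  by rewrite flags_compK // last_last_flags.
exact: comp_flagsK.
Qed.

Lemma size_comp_flags I : all (fun i => 0 < i)%N I -> size (comp_flags I) = sumn I.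
Proof.
elim: I => //= i I IH /andP[i_gt0 /IH E].
by rewrite size_cat size_nseq /= E addnS -addSn prednK.
Qed.

Lemma count_comp_flags I : count id (comp_flags I) = size I.
Proof. by elim: I => //= i I IH; rewrite count_cat count_nseq /= IH. Qed.

(** * Special inversions and nondecreasing blocks in terms of codes *)

(** Fix the left end of a special inversion: the right ends are last occurrences, hence correspond
    to the distinct smaller letters further right. [undup] keeps exactly the last occurrences. *)
Lemma sinv_code w : sinv w = sumn (code w).
Proof.
elim: w => [|a v IH]; first by rewrite /sinv big_nil.
rewrite /= -IH /sinv /= big_nat_recl // big_geq // add0n.
under eq_bigr => j _ do rewrite big_nat_recl //=.
rewrite big_split /=; congr (_ + _)%N.
elim: v {IH} => [|b v IH]; first by rewrite big_nil.
rewrite /= big_nat_recl //= /last_occ /= drop0.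
rewrite [X in (_ + X)%N]IH; case: (b \in v); first by rewrite andbF.
by rewrite andbT.
Qed.

(** Compare neighbours a, b. If a <= b, every letter counted for a is counted for b. If b < a, then
    a counts all that b counts and also b itself. *)
Lemma sorted_take_code j w : sorted leq (take j w) = sorted leq (take j (code w)).
Proof.
elim: w j => [|a v IH] [|j] //=.
case: v j IH => [|b v] [|j] //= /(_ j.+1) /= ->; congr andb.
apply/idP/idP => [le_ab|].
  have -> : count (fun x => (x < a)%N) (if b \in v then undup v else b :: undup v)
          = count (fun x => (x < a)%N) (undup v).
    by case: (b \in v); rewrite //= ltnNge le_ab.
  by apply: sub_count => x /= lt_xa; apply: leq_trans le_ab.
apply: contraLR; rewrite -!ltnNge => lt_ba.
have [bv|bNv] := boolP (b \in v); last first.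
  rewrite /= lt_ba add1n ltnS; apply: sub_count => x /= lt_xb.
  exact: ltn_trans lt_ba.
have pu : perm_eq (undup v) (b :: rem b (undup v)) by rewrite perm_to_rem // mem_undup.
rewrite !(permP pu) /= ltnn lt_ba add0n add1n ltnS; apply: sub_count => x /= lt_xb.
exact: ltn_trans lt_ba.
Qed.

Lemma code_drop j w : code (drop j w) = drop j (code w).
Proof. by elim: w j => [|a v IH] [|j] //=. Qed.

Lemma blocks_sorted_code J w : blocks_sorted J w = blocks_sorted J (code w).
Proof. by elim: J w => //= j J IH w; rewrite sorted_take_code IH code_drop. Qed.

(** * Packed words with prescribed flags *)

(** The maximum of a packed word equals its number of distinct letters, so its alphabet depends on
    the flags alone. *)
Lemma packedP w :
  reflect (forall x, (x \in w) = (0 < x <= count id (last_flags w))%N) (packed w).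
Proof.
have le_max x : x \in w -> (x <= foldr maxn 0 w)%N.
  elim: w => //= a v IH; rewrite in_cons leq_max.
  by case/orP => [/eqP->|/IH ->]; rewrite ?leqnn ?orbT.
apply: (iffP idP) => [/andP[w0 /allP wmax]|mem_w].
  have E : w =i iota 1 (foldr maxn 0 w).
    move=> x; apply/idP/idP => [xw|/wmax//].
    rewrite mem_iota add1n ltnS le_max // andbT lt0n.
    by apply: contraNneq w0 => <-.
  have -> : count id (last_flags w) = foldr maxn 0%N w.
    rewrite -size_undup_flags -(size_iota 1 (foldr maxn 0 w)).
    apply/perm_size/uniq_perm; rewrite ?undup_uniq ?iota_uniq // => x.
    by rewrite mem_undup E.
  by move=> x; rewrite E mem_iota add1n ltnS.
apply/andP; split; first by rewrite mem_w.
apply/allP => x; rewrite mem_iota add1n ltnS mem_w => /andP[-> /leq_trans -> //].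
have : all (fun y => y <= count id (last_flags w))%N w.
  by apply/allP => y; rewrite mem_w => /andP[].
move: (count _ (last_flags w)) => k.
by elim: (w) => //= a v IH /andP[le_a /IH]; rewrite geq_max le_a.
Qed.

Lemma count_undup_packed w c : packed w -> (c <= count id (last_flags w))%N ->
  count (fun x => (x < c.+1)%N) (undup w) = c.
Proof.
move=> /packedP mem_w le_c.
have /permP -> : perm_eq (undup w) (iota 1 (count id (last_flags w))).
  apply: uniq_perm; rewrite ?undup_uniq ?iota_uniq // => x.
  by rewrite mem_undup mem_w mem_iota add1n ltnS.
rewrite -(subnKC le_c) iotaD count_cat.
have -> : count (fun x => x < c.+1)%N (iota 1 c) = c.
  rewrite -[RHS](size_iota 1); apply/eqP; rewrite -all_count.
  by apply/allP => x; rewrite mem_iota; lia.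
rewrite (@eq_in_count _ _ pred0) ?count_pred0 ?addn0 // => x.
by rewrite mem_iota /=; lia.
Qed.

Lemma code_map_bump h v : code (map (bump h) v) = code v.
Proof.
elim: v => //= a v ->; congr (_ :: _).
rewrite undup_map_inj; last exact: (can_inj (bumpK h)).
rewrite count_map; apply: eq_count => x /=.
by rewrite /bump; lia.
Qed.

(** The letters of [v] fill an interval starting at 1, so exactly [c] of them lie below [c.+1]. For
    a new letter, [bump] frees the value [c.+1] without changing the order. *)
Lemma insert_letterP (b : bool) c v : packed v -> (c < count id (last_flags v) + b)%N ->
  [/\ packed (insert_letter b c v),
      last_flags (insert_letter b c v) = b :: last_flags v &
      code (insert_letter b c v) = c :: code v].
Proof.
move=> pv lt_c; have mem_v := packedP _ pv.
case: b lt_c => /= lt_c; last first.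
  have cv : c.+1 \in v by rewrite mem_v; lia.
  split; rewrite /= ?cv //; last by rewrite count_undup_packed //; lia.
  apply/packedP => x; rewrite /= in_cons cv -mem_v.
  by case: eqP => // ->; rewrite cv.
have binj : injective (bump c.+1) := can_inj (bumpK c.+1).
have cNv : c.+1 \notin map (bump c.+1) v.
  by apply/mapP => -[x _ E]; move: E; rewrite /bump; lia.
have lf : last_flags (insert_letter true c v) = true :: last_flags v.
  by rewrite /= cNv last_flags_map.
split; rewrite //=.
  apply/packedP => x; rewrite lf /insert_letter in_cons.
  have [->|neq] := eqVneq x c.+1; first by rewrite /=; lia.
  rewrite -(unbumpK (h := c.+1) (x := x)) ?inE // mem_map // mem_v /=.
  by move/eqP: neq; rewrite /unbump /bump; lia.
rewrite code_map_bump undup_map_inj // count_map; congr (_ :: _).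
rewrite -[RHS](count_undup_packed v) //; last by lia.
by apply: eq_count => x /=; rewrite /bump; lia.
Qed.

Lemma mem_flagged_words bs w :
  (w \in flagged_words bs) = packed w && (last_flags w == bs).
Proof.
elim: bs w => [|b bs IH] w.
  by rewrite inE; case: w => [|a w] //=; rewrite andbF.
apply/allpairsP/andP => [[[c v] /= [cN]]|[]].
  rewrite IH => /andP[pv /eqP lfv] ->.
  move: cN; rewrite mem_iota /= => cN.
  have [|pw lfw _] := @insert_letterP b c v pv; first by rewrite lfv; lia.
  by split; [exact: pw | apply/eqP; rewrite -lfv; exact: lfw].
case: w => [|a v] //= /packedP mem_w /eqP[Eb Ebs].
have a_w : (0 < a <= count id (last_flags (a :: v)))%N by rewrite -mem_w mem_head.
have Ea : a.-1.+1 = a by rewrite prednK; case/andP: a_w.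
move: mem_w a_w; rewrite /= Eb Ebs => mem_w a_w.
case: b Eb mem_w a_w => Eb mem_w a_w.
  (* The new letter [a] does not occur in [v]; closing this gap makes the tail packed again. *)
  pose v' := map (unbump a) v.
  have vE : v = map (bump a) v'.
    rewrite -map_comp -[LHS]map_id; apply/eq_in_map => x xv /=.
    rewrite unbumpK // inE; apply: contraTneq xv => ->; exact: Eb.
  exists (a.-1, v'); split; last by rewrite /insert_letter /= Ea -vE.
    by rewrite mem_iota /=; lia.
  have binj : injective (bump a) := can_inj (bumpK a).
  have lf' : last_flags v' = bs by rewrite -Ebs vE last_flags_map.
  rewrite IH lf' eqxx andbT; apply/packedP => x.
  rewrite lf' -(mem_map binj) -vE.
  have := mem_w (bump a x); rewrite in_cons eq_sym (negbTE (neq_bump _ _)) /= => ->.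
  by move: a_w; rewrite /bump; lia.
exists (a.-1, v); split; last by rewrite /insert_letter /= Ea.
  by rewrite mem_iota /=; lia.
rewrite IH Ebs eqxx andbT; apply/packedP => x; rewrite Ebs -[count _ _]add0n -mem_w.
rewrite in_cons; case: eqP => // ->; exact: (negbFE Eb).
Qed.

Lemma map_code_flagged_words bs : map code (flagged_words bs) = codes bs.
Proof.
elim: bs => //= b bs IH.
rewrite map_allpairs -IH allpairs_mapr; apply/eq_in_allpairs => c v /=.
rewrite mem_iota mem_flagged_words => cN /andP[pv /eqP lfv].
by have [|_ _ //] := @insert_letterP b c v pv; rewrite lfv; lia.
Qed.

Lemma uniq_codes bs : uniq (codes bs).
Proof.
elim: bs => //= b bs IH; apply: allpairs_uniq; rewrite ?iota_uniq //.
by move=> [c cs] [c' cs'] _ _ /= [-> ->].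
Qed.

(** Distinct codes force distinct words. *)
Lemma uniq_flagged_words bs : uniq (flagged_words bs).
Proof. by apply: (map_uniq (f := code)); rewrite map_code_flagged_words uniq_codes. Qed.

Lemma mem_words n m w :
  (w \in words n m) = (size w == n) && all (fun x => 0 < x <= m)%N w.
Proof.
elim: n w => [|n IH] w; first by rewrite inE; case: w.
apply/allpairsP/andP => [[[a v] /= [am]]|].
  rewrite IH => /andP[/eqP sv av] ->; rewrite /= sv av andbT; split=> //.
  by move: am; rewrite mem_iota; lia.
case: w => [|a v] [] // sv /andP[am av]; exists (a, v); split=> //=.
  by rewrite mem_iota; lia.
by rewrite IH; apply/andP.
Qed.

Lemma uniq_packed_words n : uniq (packed_words n).
Proof.
(* The alphabet size must stay fixed while the length varies in the induction. *)
apply: filter_uniq; move: {2}n => m; elim: n => //= n IH.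
apply: allpairs_uniq; rewrite ?iota_uniq //.
by move=> [c cs] [c' cs'] _ _ /= [-> ->].
Qed.

Lemma mem_packed_words n w : (w \in packed_words n) = packed w && (size w == n).
Proof.
rewrite mem_filter mem_words; case: (boolP (packed w)) => //= /packedP mem_w.
case: eqP => //= <-; apply/allP => x; rewrite mem_w => /andP[-> /leq_trans -> //].
by rewrite -size_undup_flags size_undup.
Qed.

Lemma perm_flagged_words bs :
  perm_eq [seq w <- packed_words (size bs) | last_flags w == bs] (flagged_words bs).
Proof.
apply: uniq_perm; first exact/filter_uniq/uniq_packed_words.
  exact: uniq_flagged_words.
move=> w; rewrite mem_filter mem_flagged_words mem_packed_words andbC -andbA.
case: (_ =P bs) => [<-|]; last by rewrite !andbF.
by rewrite size_last_flags eqxx.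
Qed.

(** * Packing and sortedness *)

Lemma size_pack w : size (pack w) = size w.
Proof. exact: size_map. Qed.

Lemma pack_packed w : packed (pack w).
Proof.
set s := sort leq (undup w).
have mem_s x : (x \in s) = (x \in w) by rewrite mem_sort mem_undup.
have mem_p x : (x \in pack w) = (0 < x <= size s)%N.
  apply/mapP/idP => [[y yw ->]|/andP[x_gt0 le_x]].
    by rewrite ltnS leq0n /= index_mem mem_s.
  have lt_x : (x.-1 < size s)%N by rewrite prednK.
  exists (nth 0%N s x.-1); first by rewrite -mem_s mem_nth.
  by rewrite index_uniq ?prednK // sort_uniq undup_uniq.
apply/packedP => x; rewrite mem_p -size_undup_flags; congr (_ && (_ <= _))%N.
rewrite -[LHS](size_iota 1); apply/esym/perm_size/uniq_perm.
- exact: undup_uniq.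
- exact: iota_uniq.
by move=> y; rewrite mem_undup mem_p mem_iota add1n ltnS.
Qed.

Lemma sorted_take_map (f : nat -> nat) (w : seq nat) j :
  {in w &, {mono f : x y / (x <= y)%N}} ->
  sorted leq (take j (map f w)) = sorted leq (take j w).
Proof.
move=> fmono; rewrite -map_take sorted_map; apply: (@eq_in_sorted _ (mem w)); first exact: fmono.
by apply/allP => x /mem_take.
Qed.

Lemma blocks_sorted_map (f : nat -> nat) J (w : seq nat) :
  {in w &, {mono f : x y / (x <= y)%N}} ->
  blocks_sorted J (map f w) = blocks_sorted J w.
Proof.
elim: J w => //= j J IH w fmono; rewrite sorted_take_map // -map_drop IH //.
by move=> x y /mem_drop xw /mem_drop yw; apply: fmono.
Qed.

(** This lets block conditions pass between a factor of a word and its packing. *)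
Lemma pack_mono (w : seq nat) :
  {in w &, {mono (fun x => (index x (sort leq (undup w))).+1) : x y / (x <= y)%N}}.
Proof.
set s := sort leq (undup w).
have mem_s x : (x \in s) = (x \in w) by rewrite mem_sort mem_undup.
have ss : sorted leq s by apply: sort_sorted; apply: leq_total.
move=> x y; rewrite -!mem_s ltnS => xs ys.
have [le_i|lt_i] := leqP (index x s) (index y s).
  exact/esym/(sorted_leq_index leq_trans leqnn ss).
have le_yx := sorted_ltn_index leq_trans ss _ _ ys xs lt_i.
apply/esym/negbTE; rewrite -ltnNge ltn_neqAle le_yx andbT.
by apply: contraTneq lt_i => ->; rewrite ltnn.
Qed.

Lemma sinv_sorted w : sorted leq w -> sinv w = 0%N.
Proof.
move=> sw; rewrite /sinv big_nat_cond big1 // => j /andP[/andP[_ lt_j] _].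
rewrite big_nat_cond big1 // => i /andP[/andP[_ lt_i] _].
have lt_iw := ltn_trans lt_i lt_j.
by rewrite ltnNge (sorted_leq_nth leq_trans leqnn 0%N sw i j lt_iw lt_j (ltnW lt_i)).
Qed.

(** * Expansion of the iterated q-product *)

Lemma qq_neq0 : qq != 0.
Proof. by rewrite /qq tofrac_eq0 polyX_eq0. Qed.

(** Collapses a sum over packed factors: a word determines the packings of its prefix and suffix. *)
Lemma sum_mem_eq (s : seq (seq nat)) (P : pred (seq nat)) (x : seq nat) (c : Rq) :
  uniq s -> x \in s -> \sum_(y <- s | P y) (if x == y then c else 0) = if P x then c else 0.
Proof.
move=> us xs; rewrite (big_rem x) //= eqxx big_seq_cond big1 ?addr0 //.
move=> y /andP[]; rewrite mem_rem_uniq // inE => /andP[/negbTE yx _] _.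
by rewrite eq_sym yx.
Qed.

(* Since M'_w = q^(sinv w) M_w multiply as the M_w, and sinv vanishes on the
   terms of alpha(S_j), the normalisations telescope in the iterated product. *)
Lemma sum_prodJ J (f : seq nat -> Rq) :
  \sum_(t <- prodJ J) t.2 * f t.1 =
  \sum_(w <- packed_words (sumn J) | blocks_sorted J w) qq ^+ sinv w * f w.
Proof.
elim: J f => [|j J IH] f.
  by rewrite /prodJ /= big_seq1 /packed_words /= big_seq1 /sinv big_nil expr0.
rewrite [prodJ _]/= -/(prodJ J) /starq big_flatten big_allpairs_dep /=.
transitivity (\sum_(u <- packed_words j | sorted leq u)
  \sum_(w <- packed_words (j + sumn J))
  \sum_(v <- packed_words (sumn J) | blocks_sorted J v)
    if pack (take j w) == u then
      if pack (drop j w) == v then qq ^+ sinv w * f w else 0 else 0).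
  rewrite big_map big_filter big_seq_cond [RHS]big_seq_cond.
  apply: eq_bigr => u /andP[]; rewrite mem_packed_words => /andP[_ /eqP su] sortu.
  rewrite [RHS]exchange_big /=.
  (* Absorbing the product with [u] into the test function makes the induction hypothesis
     applicable. *)
  pose g v := \sum_(w <- prodM u v) qq ^+ sinv w / qq ^+ sinv v * f w.
  transitivity (\sum_(t <- prodJ J) t.2 * g t.1).
    apply: eq_bigr => t _; rewrite /g big_map big_map mulr_sumr.
    by apply: eq_bigr => w _; rewrite /= (sinv_sorted u) // expr0 !mul1r !mulrA.
  rewrite IH big_seq_cond [RHS]big_seq_cond.
  apply: eq_bigr => v /andP[]; rewrite mem_packed_words => /andP[_ /eqP sv] _.
  rewrite /g /prodM big_filter su sv mulr_sumr big_mkcond.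
  apply: eq_bigr => w _; case: eqP => //= _; case: eqP => //= _.
  (* The weight of [v] from the induction hypothesis cancels the denominator. *)
  by rewrite mulrA [qq ^+ _ * _]mulrC divfK // expf_neq0 // qq_neq0.
rewrite exchange_big /= [RHS]big_mkcond big_seq [RHS]big_seq.
apply: eq_bigr => w; rewrite mem_packed_words => /andP[_ /eqP sw].
have st : size (take j w) = j by rewrite size_take sw; case: ltngtP; lia.
have sd : size (drop j w) = sumn J by rewrite size_drop sw addKn.
transitivity (\sum_(u <- packed_words j | sorted leq u)
  if pack (take j w) == u then
    if blocks_sorted J (drop j w) then qq ^+ sinv w * f w else 0 else 0).
  apply: eq_bigr => u _; case: eqP => _; last by rewrite big1.
  rewrite sum_mem_eq ?uniq_packed_words //;
    last by rewrite mem_packed_words pack_packed size_pack sd eqxx.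
  by rewrite blocks_sorted_map //; apply: pack_mono.
rewrite sum_mem_eq ?uniq_packed_words //;
  last by rewrite mem_packed_words pack_packed size_pack st eqxx.
have -> : sorted leq (pack (take j w)) = sorted leq (take j w).
  rewrite -[pack _](take_size) sorted_take_map; last exact: pack_mono.
  by rewrite size_map take_size.
by rewrite -if_and.
Qed.

Definition code_gf (bs : seq bool) (J : seq nat) : Rq :=
  \sum_(cs <- codes bs | blocks_sorted J cs) qq ^+ sumn cs.

(** Fixing the W-composition fixes the flags, after which words may be replaced by their codes. *)
Lemma CIJ_code_gf I J : all (fun i => 0 < i)%N I -> sumn I = sumn J ->
  CIJ I J = code_gf (comp_flags I) J.
Proof.
move=> I_gt0 sIJ; rewrite /CIJ /coefPsi /SJ /zeta big_map /=.
transitivity (\sum_(t <- prodJ J) t.2 * (WC t.1 == I)%:R).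
  by rewrite big_mkcond; apply: eq_bigr => t _; case: eqP; rewrite ?mulr1 ?mulr0.
rewrite (sum_prodJ J (fun w => (WC w == I)%:R)) -sIJ -size_comp_flags //.
rewrite /code_gf -map_code_flagged_words big_map.
rewrite -(perm_big _ (perm_flagged_words _)) [RHS]big_filter_cond big_mkcond [RHS]big_mkcond /=.
apply: eq_bigr => w _; rewrite WC_eq // -blocks_sorted_code sinv_code.
by case: (blocks_sorted J w); case: (_ == _); rewrite ?mulr1 ?mulr0.
Qed.

(** * Gaussian binomials and nondecreasing words *)

Lemma qintD a b : qint (a + b) = qint a + qq ^+ a * qint b.
Proof.
rewrite /qint big_split_ord /= mulr_sumr; congr (_ + _).
by apply: eq_bigr => i _; rewrite exprD.
Qed.

(** The underlying polynomial has constant coefficient 1. *)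
Lemma qint_neq0 m : qint m.+1 != 0.
Proof.
have -> : qint m.+1 = @FracField.tofrac {poly int} (\sum_(i < m.+1) 'X^i).
  by rewrite /qint rmorph_sum; apply: eq_bigr => i _; rewrite rmorphXn.
rewrite tofrac_eq0; apply/eqP => /(congr1 (fun p : {poly int} => p`_0)).
rewrite coef_sum big_ord_recl /= coefXn big1 ?addr0 ?coef0 // => i _.
by rewrite coefXn.
Qed.

Lemma qfactS m : qfact m.+1 = qfact m * qint m.+1.
Proof. by rewrite /qfact big_nat_recr. Qed.

Lemma qfact_neq0 m : qfact m != 0.
Proof.
elim: m => [|m IH]; first by rewrite /qfact big_geq // oner_neq0.
by rewrite qfactS; apply: mulf_neq0 IH (qint_neq0 m).
Qed.

Lemma qbinom0 a : qbinom a 0 = 1.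
Proof.
rewrite /qbinom subn0 leq0n [qfact 0]big_geq // mul1r.
exact: divff (qfact_neq0 a).
Qed.

Lemma qbinomnn a : qbinom a a = 1.
Proof.
rewrite /qbinom subnn leqnn [qfact 0]big_geq // mulr1.
exact: divff (qfact_neq0 a).
Qed.

(** The q-Pascal rule with factorials and q-integers abstracted to field elements. *)
Lemma pascal_fraction (F : fieldType) (a d e x y z : F) :
  d != 0 -> e != 0 -> x != 0 -> y != 0 ->
  a * (y + z * x) / (e * y * (d * x)) = a / (e * (d * x)) + z * (a / (e * y * d)).
Proof. by move=> d0 e0 x0 y0; field; rewrite d0 e0 x0 y0. Qed.

Lemma qbinom_pascal d j : qbinom (d.+1 + j.+1) j.+1 =
  qbinom (d.+1 + j) j + qq ^+ j.+1 * qbinom (d + j.+1) j.+1.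
Proof.
rewrite /qbinom !leq_addl !addnK [(d.+1 + j.+1)%N]addSn.
rewrite [(d.+1 + j)%N]addSnnS.
rewrite (qfactS (d + j.+1)) (qfactS j) (qfactS d).
have -> : qint (d + j.+1).+1 = qint j.+1 + qq ^+ j.+1 * qint d.+1.
  by rewrite -qintD -addSn addnC.
exact: pascal_fraction (qfact_neq0 d) (qfact_neq0 j) (qint_neq0 d) (qint_neq0 j).
Qed.

(* Generating function of the nondecreasing words of length j over [m, K). *)
Fixpoint hq (j m K : nat) : Rq :=
  if j is j'.+1 then \sum_(m <= c < K) qq ^+ c * hq j' c K else 1.

Lemma hq_qbinom j d m : hq j m (m + d.+1) = qq ^+ (m * j) * qbinom (d + j) j.
Proof.
elim: j d m => [|j IHj] d m; first by rewrite muln0 expr0 qbinom0 mulr1.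
(* Either the first letter is the least one, [k], or all letters exceed [k]. *)
have hqS e k : hq j.+1 k (k + e.+1) = qq ^+ k * hq j k (k + e.+1) + hq j.+1 k.+1 (k + e.+1).
  by rewrite [LHS]/= big_ltn // addnS ltnS leq_addr.
elim: d m => [|d IHd] m; rewrite hqS IHj.
  by rewrite [hq _ _ _]big_geq ?addn1 // addr0 !add0n !qbinomnn !mulr1 mulnS exprD.
rewrite -addSnnS IHd.
rewrite qbinom_pascal mulrDr !mulrA -!exprD.
by congr (qq ^+ _ * _ + qq ^+ _ * _); lia.
Qed.

(** * Factorisation over blocks *)

(** The lower bound [m] carries the previous entry of the block through the induction. Bounds
    decrease weakly along the flags, so the one at index [j.-1] governs the whole block. *)
Lemma code_gf_block j m bs J : (j <= size bs)%N ->
  \sum_(cs <- codes bs | path leq m (take j cs) && blocks_sorted J (drop j cs))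
     qq ^+ sumn cs
  = hq j m (count id (drop j.-1 bs)) * code_gf (drop j bs) J.
Proof.
elim: j m bs => [|j IH] m bs.
  move=> _; rewrite mul1r drop0; apply: eq_bigl => cs.
  by rewrite take0 drop0.
case: bs => [|b bs] //=; rewrite ltnS => le_j.
rewrite big_mkcond big_allpairs_dep /=.
transitivity (\sum_(0 <= c < b + count id bs | (m <= c)%N)
   qq ^+ c * hq j c (count id (drop j (b :: bs))) * code_gf (drop j bs) J).
  rewrite [RHS]big_mkcond /index_iota subn0; apply: eq_bigr => c _.
  case: (leqP m c) => /= [le_mc|_]; last by rewrite big1.
  rewrite -mulrA.
  (* The indices agree for positive [j]; for [j = 0] both sides are 1. *)
  have -> : hq j c (count id (drop j (b :: bs))) = hq j c (count id (drop j.-1 bs)).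
    by case: (j).
  rewrite -IH // mulr_sumr [RHS]big_mkcond; apply: eq_bigr => cs _.
  by case: ifP => // _; rewrite exprD.
rewrite -big_distrl /=; congr (_ * _).
rewrite -[LHS](big_nat_widenl m 0 _ predT) //.
(* In a block of one letter the bound is already the final one. Otherwise a first entry at or above
   the final bound [K] leaves no value for the next entry, so the range is cut at [K]. *)
case: j {IH le_j} => [|j] //=.
set K := count id (drop j bs).
have le_K : (K <= b + count id bs)%N.
  by rewrite /K -{2}(cat_take_drop j bs) count_cat; lia.
case: (leqP m K) => [le_mK|lt_Km]; last first.
  rewrite [RHS]big_geq; last exact: ltnW.
  rewrite big_nat; apply: big1 => c /andP[le_mc _].
  by rewrite big_geq ?mulr0 //; apply: ltnW (leq_trans lt_Km le_mc).
rewrite (big_cat_nat le_mK le_K) /= [X in _ + X]big_nat [X in _ + X]big1 ?addr0 //.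
by move=> c /andP[le_Kc _]; rewrite big_geq ?mulr0.
Qed.

Lemma code_gf_cons bs j J : (j <= size bs)%N ->
  code_gf bs (j :: J) = hq j 0 (count id (drop j.-1 bs)) * code_gf (drop j bs) J.
Proof.
move=> le_j; rewrite -code_gf_block //; apply: eq_bigl => cs /=.
by congr (_ && _); case: (take j cs).
Qed.

(** * The two rules *)

Lemma remove_cells_head j i I : (0 < j <= i)%N ->
  remove_cells j (i :: I) = if (j < i)%N then (i - j)%N :: I else I.
Proof.
case: j => //= j le_ji; case: ltnP => // le_ij.
by have -> : (j.+1 - i)%N = 0%N by [lia]; case: I.
Qed.

Theorem mainTheorem5 (n : nat) (I J : seq nat) :
  (0 < n)%N -> is_comp n I -> is_comp n J ->
  ((head 0%N I < head 0%N J)%N ->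
     CIJ I J = CIJ ((nth 0%N I 0 + nth 0%N I 1)%N :: drop 2 I) J) /\
  (~~ (head 0%N I < head 0%N J)%N ->
     CIJ I J = qbinom (size I + head 0%N J - 1) (head 0%N J)
               * CIJ (remove_cells (head 0%N J) I) (behead J)).
Proof.
move=> n_gt0 /andP[/eqP sI I_gt0] /andP[/eqP sJ J_gt0].
case: J sJ J_gt0 => [|j J] sJ J_gt0; first by rewrite -sJ in n_gt0.
case: I sI I_gt0 => [|i I] sI I_gt0; first by rewrite -sI in n_gt0.
have {J_gt0} /andP[j_gt0 J_gt0] := J_gt0.
have [i_gt0 I'_gt0] := andP I_gt0.
have le_j : (j <= size (comp_flags (i :: I)))%N.
  by rewrite size_comp_flags // sI -sJ leq_addr.
rewrite (CIJ_code_gf (i :: I)) ?sI // code_gf_cons //.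
split=> [/= lt_ij|].
  case: I sI I_gt0 I'_gt0 le_j => [|i2 I] sI I_gt0 /= I'_gt0 le_j.
    by move: sI sJ lt_ij => /=; lia.
  have [i2_gt0 I2_gt0] := andP I'_gt0.
  have I3_gt0 : all (fun x => 0 < x)%N ((i + i2)%N :: I) by rewrite /= addn_gt0 i_gt0.
  have s3 : sumn ((i + i2)%N :: I) = sumn (j :: J) by rewrite sJ -sI /= addnA.
  rewrite drop0 CIJ_code_gf // code_gf_cons; last by rewrite size_comp_flags // s3 leq_addr.
  (* Merging the first two parts only clears the flag at index [i.-1]. Since [i < j], both
     [drop j.-1] and [drop j] start beyond it. *)
  have dropE k : (i <= k)%N ->
      drop k (comp_flags [:: i, i2 & I]) = drop k (comp_flags ((i + i2)%N :: I)).
    move=> le_ik; rewrite -(subnK le_ik) -!drop_drop; congr (drop _ _) => /=.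
    have -> : (i + i2).-1 = (i + i2.-1)%N by lia.
    rewrite nseqD -catA [RHS]drop_size_cat ?size_nseq // -cat_rcons.
    by rewrite drop_size_cat // size_rcons size_nseq prednK.
  by rewrite -!dropE // ?(ltnW lt_ij) // -ltnS prednK.
rewrite -leqNgt => le_ji; rewrite /= in le_ji.
rewrite [head _ _]/= remove_cells_head ?j_gt0 // [behead _]/= [comp_flags _]/=.
(* As [j <= i], no last occurrence precedes cell [j], so the bound at the end of the block is the
   full number of parts. *)
have -> : drop j.-1 (nseq i.-1 false ++ true :: comp_flags I)
        = nseq (i - j) false ++ true :: comp_flags I.
  have -> : i.-1 = (j.-1 + (i - j))%N by lia.
  by rewrite nseqD -catA drop_size_cat ?size_nseq.
rewrite count_cat count_nseq /= count_comp_flags add0n add1n.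
rewrite (hq_qbinom j (size I) 0) mul0n expr0 mul1r addSn subn1 /=.
(* Removing the cells either shortens the first part or uses it up. *)
congr (_ * _); case: ltngtP le_ji => // [lt_ji|Eij] _.
  rewrite CIJ_code_gf /=; last by move: sI sJ => /=; lia.
    have -> : i.-1 = (j + (i - j).-1)%N by lia.
    by rewrite nseqD -catA drop_size_cat ?size_nseq.
  by rewrite subn_gt0 lt_ji.
rewrite Eij CIJ_code_gf //; last by move: sI sJ => /=; lia.
by rewrite -cat_rcons drop_size_cat // size_rcons size_nseq prednK.
Qed.
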